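(* Let $c\in(0,\sqrt{2})$ and $\xi\in(0,c^4/4)$. Then the problem $$z^{(4)}+c^2 z''+(z+1)^{+}-\xi (z+1)^{-}-1=0 \ \text{ on } \mathbb{R},\qquad z(t),\,z'(t)\to 0 \ \text{ as } |t|\to+\infty,$$ has at most $6$ even one-troughed solutions. Equivalently, for $a>b>0$ with $b/a\in(0,c^4/4)$, the problem $$u_{\tau\tau}+u_{xxxx}+a u^+-b u^-=1 \ (x\in\mathbb{R},\ \tau>0),\qquad u(x,\tau)\to \tfrac1a,\ u_x(x,\tau)\to 0 \text{ as } |x|\to\infty,$$ has at most $6$ even one-troughed travelling wave solutions with wave-speed parameter $c$.
   Context: Here $s^{+}=\max\{s,0\}$, $s^{-}=\max\{-s,0\}$. Travelling waves of the PDE problem are functions of the form $u(x,\tau)=\frac1a\bigl(1+z(\sqrt[4]{a}\,x-c\sqrt{a}\,\tau)\bigr)$; under this substitution the PDE problem becomes the ODE problem above with $\xi=b/a$. A solution $z$ is a $C^4$ function on $\mathbb{R}$ satisfying the ODE and the decay conditions. A solution $z$ is called even if $z(-t)=z(t)$ for all $t$, and one-troughed if there are exactly two points $t\in\mathbb{R}$ with $z(t)=-1$ (so that $z$ drops below $-1$ on exactly one interval). The corresponding travelling wave is called even/one-troughed accordingly. *)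

(* Defs.v *)
From Stdlib Require Import Reals List.
From Coquelicot Require Import Coquelicot.
Open Scope R_scope.

Definition pos_part (s : R) : R := Rmax s 0.
Definition neg_part (s : R) : R := Rmax (- s) 0.

Definition isC4 (z : R -> R) : Prop :=
  (forall (k : nat) (t : R), (k <= 4)%nat -> ex_derive_n z k t) /\
  (forall t : R, continuous (Derive_n z 4) t).

Definition is_solution (c xi : R) (z : R -> R) : Prop :=
  isC4 z /\
  (forall t : R,
     Derive_n z 4 t + c ^ 2 * Derive_n z 2 t
     + pos_part (z t + 1) - xi * neg_part (z t + 1) - 1 = 0) /\
  is_lim z p_infty 0 /\ is_lim z m_infty 0 /\
  is_lim (Derive z) p_infty 0 /\ is_lim (Derive z) m_infty 0.

Definition is_even (z : R -> R) : Prop := forall t : R, z (- t) = z t.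

Definition one_troughed (z : R -> R) : Prop :=
  exists t1 t2 : R, t1 <> t2 /\
    forall t : R, z t = -1 <-> (t = t1 \/ t = t2).

(* Main.v *)
(** Let T > 0 be the point where z = -1 and s = z'(T). To the right of T the
equation factors as (D^2 + 2pD + 1)(D^2 - 2pD + 1) z = 0 with 4p^2 = 2 - c^2 (write q^2 = 1 - p^2), and
decay kills the unstable factor, so z is a damped oscillation determined by s.
Inside the trough z + 1 - 1/xi is an even combination of cos (w1 t) and cos (w2 t).
Matching at T gives, for each frequency, w_i T = atan (w_i s) + const (mod pi).
Negativity of z + 1 in the trough forces w2 T < pi/2, which fixes the branch for w2
and makes T a function of s; then w1 T - atan (w1 s) is strictly increasing in s
while it has to lie in kappa + pi Z. Finally z > -1 at the first minimum after T
gives w1 T < c (s - 2p) < c exp ((p/q) (pi + atan (q/p))) <= 6 pi, so that at most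
six values remain. *)

Require Import Defs.
From Stdlib Require Import Reals List Lra Lia Machin.
From Stdlib Require Import Classical FunctionalExtensionality.
From Coquelicot Require Import Coquelicot.
Open Scope R_scope.

(** * Numerical bounds *)

Lemma PI_bounds : 157 / 50 < PI < 22 / 7.
Proof.
  destruct (PI_2_3_7_ineq 1) as [H1 H2].
  unfold PI_2_3_7_tg, tg_alt, Ratan_seq in *. simpl in *. lra.
Qed.

(** One step of repeated squaring; [d] leaves room to round the square down to a short rational. *)
Lemma exp_neg_double (a b d : R) :
  0 <= b -> b <= exp (- a) -> d <= b * b -> d <= exp (- (2 * a)).
Proof.
  intros Hb H Hd. replace (- (2 * a)) with (- a + - a) by ring.
  rewrite exp_plus. nra.
Qed.

Lemma exp_55_8_bound : exp (55 / 8) <= 1050.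
Proof.
  (* Here [55 / 4096] is [55 / 8] divided by 2^9, so nine doublings follow. The negative exponent
     lets 1 + x <= exp x serve as the starting lower bound. *)
  assert (H : 4041 / 4096 <= exp (- (55 / 4096))).
  { generalize (exp_ineq1_le (- (55 / 4096))). lra. }
  apply exp_neg_double with (d := 9733 / 10000) in H; [|lra..].
  apply exp_neg_double with (d := 9473 / 10000) in H; [|lra..].
  apply exp_neg_double with (d := 8973 / 10000) in H; [|lra..].
  apply exp_neg_double with (d := 8051 / 10000) in H; [|lra..].
  apply exp_neg_double with (d := 6481 / 10000) in H; [|lra..].
  apply exp_neg_double with (d := 42 / 100) in H; [|lra..].
  apply exp_neg_double with (d := 1764 / 10000) in H; [|lra..].
  apply exp_neg_double with (d := 311 / 10000) in H; [|lra..].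
  apply exp_neg_double with (d := 1 / 1050) in H; [|lra..].
  replace (- _) with (- (55 / 8)) in H by field.
  assert (E : exp (55 / 8) * exp (- (55 / 8)) = 1).
  { rewrite <- exp_plus, Rplus_opp_r. apply exp_0. }
  generalize (exp_pos (55 / 8)). nra.
Qed.

(** The difference of the two sides vanishes at 0 and has the nonnegative derivative 4 x^4 / ((1 +
    x^2) (3 + x^2)^2). *)
Lemma atan_lower_pade (x : R) : 0 <= x -> 3 * x / (3 + x ^ 2) <= atan x.
Proof.
  intros Hx. destruct (Req_dec x 0) as [->|Hn].
  { rewrite atan_0. lra. }
  destruct (MVT_gen (fun x => atan x - 3 * x / (3 + x ^ 2)) 0 x
     (fun x => 4 * x ^ 4 / ((1 + x ^ 2) * (3 + x ^ 2) ^ 2))) as [y [Hy E]].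
  - intros y _. auto_derive.
    + nra.
    + unfold Rsqr. field. split; nra.
  - intros y _. apply derivable_continuous_pt. apply ex_derive_Reals_0.
    auto_derive. nra.
  - rewrite atan_0 in E.
    assert (0 <= 4 * y ^ 4 / ((1 + y ^ 2) * (3 + y ^ 2) ^ 2)).
    { apply Rle_mult_inv_pos. nra. apply Rmult_lt_0_compat; [nra|]. apply pow_lt. nra. }
    assert (0 <= 4 * y ^ 4 / ((1 + y ^ 2) * (3 + y ^ 2) ^ 2) * (x - 0)) by (apply Rmult_le_pos; lra).
    lra.
Qed.

(* Up to rounding, the tangent line at 0.85 of the Pade minorant of x atan x. *)
Lemma x_atan_lower (x : R) : 0 <= x <= 1 -> 1104 / 1000 * x - 3562 / 10000 <= x * atan x.
Proof.
  intros Hx. apply Rle_trans with (x * (3 * x / (3 + x ^ 2))).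
  - assert (0 <= x * (3 * x / (3 + x ^ 2)) - (1104 / 1000 * x - 3562 / 10000)); [|lra].
    replace (x * (3 * x / (3 + x ^ 2)) - (1104 / 1000 * x - 3562 / 10000)) with
     ((3 * x ^ 2 - (1104 / 1000 * x - 3562 / 10000) * (3 + x ^ 2)) / (3 + x ^ 2)) by (field; nra).
    (* The numerator is a cubic with a near double root at 0.854, so multiples of this square
       certify its sign. *)
    assert (0 <= (x - 854 / 1000) ^ 2 * (1 - x))
      by (apply Rmult_le_pos; [apply pow2_ge_0|lra]).
    apply Rle_mult_inv_pos; [|nra].
    generalize (pow2_ge_0 (x - 854 / 1000)). nra.
  - apply Rmult_le_compat_l; [lra|]. now apply atan_lower_pade, Hx.
Qed.

Lemma exp_le_compat (x y : R) : x <= y -> exp x <= exp y.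
Proof.
  intros [H|H]; [now apply Rlt_le, exp_increasing|rewrite H; lra].
Qed.

(* The logarithm of the left-hand side is concave with its maximum near 0.85; each factor
   is replaced by an exponential tangent there, the slopes being chosen to cancel. *)
Lemma exp_growth_bound (x : R) : 0 < x < 1 ->
  2 * ((1 - x ^ 2) / (1 + x ^ 2)) * exp (2 * (x * (3 * PI / 2 - atan x))) <= 36 * PI ^ 2.
Proof.
  intros Hx.
  assert (HPI := PI_bounds).
  (* [66 / 7] bounds 3 pi, [1104 / 1000] is the slope in [x_atan_lower], and [4466 / 10000] is the
     rate in [H2]. With this [l] the total exponent is free of [x] and just below [55 / 8]. *)
  set (l := 66 / 7 - 2 * (1104 / 1000) - 4466 / 10000).
  assert (H1 : 1 - x <= exp (l * (1 - x) - 1) / l).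
  { generalize (exp_ineq1_le (l * (1 - x) - 1)). intros H.
    apply Rmult_le_reg_l with l; [unfold l; lra|].
    replace (l * (exp (l * (1 - x) - 1) / l)) with (exp (l * (1 - x) - 1)) by (field; unfold l; lra).
    lra. }
  assert (H2 : (1 + x) / (1 + x ^ 2) <= 10745 / 10000 * exp (4466 / 10000 * (85 / 100 - x))).
  { apply Rle_trans with (10745 / 10000 * (1 + 4466 / 10000 * (85 / 100 - x))).
    - apply Rmult_le_reg_r with (1 + x ^ 2); [nra|].
      replace ((1 + x) / (1 + x ^ 2) * (1 + x ^ 2)) with (1 + x) by (field; nra).
      assert (0 <= (x - 85 / 100) ^ 2 * (1 - x))
        by (apply Rmult_le_pos; [apply pow2_ge_0|lra]).
      generalize (pow2_ge_0 (x - 85 / 100)). nra.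
    - generalize (exp_ineq1_le (4466 / 10000 * (85 / 100 - x))). lra. }
  assert (H3 : exp (2 * (x * (3 * PI / 2 - atan x)))
    <= exp (66 / 7 * x - 2 * (1104 / 1000 * x - 3562 / 10000))).
  { apply exp_le_compat. generalize (x_atan_lower x). nra. }
  apply Rle_trans with (2 * (10745 / 10000) / l * exp (55 / 8)).
  - replace (2 * ((1 - x ^ 2) / (1 + x ^ 2))) with (2 * ((1 - x) * ((1 + x) / (1 + x ^ 2)))) by (field; nra).
    apply Rle_trans with (2 * ((exp (l * (1 - x) - 1) / l) * (10745 / 10000 * exp (4466 / 10000 * (85 / 100 - x))))
       * exp (66 / 7 * x - 2 * (1104 / 1000 * x - 3562 / 10000))).
    + assert (0 <= (1 + x) / (1 + x ^ 2)) by (apply Rle_mult_inv_pos; nra).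
      apply Rmult_le_compat; try apply Rlt_le, exp_pos; try assumption.
      * nra.
      * apply Rmult_le_compat_l; [lra|]. apply Rmult_le_compat; lra.
    + match goal with |- ?L <= _ => replace L with (2 * (10745 / 10000) / l *
        (exp (l * (1 - x) - 1) * exp (4466 / 10000 * (85 / 100 - x)) *
         exp (66 / 7 * x - 2 * (1104 / 1000 * x - 3562 / 10000)))) by (field; unfold l; lra) end.
      rewrite <- !exp_plus. apply Rmult_le_compat_l.
      * apply Rle_mult_inv_pos; unfold l; lra.
      * apply exp_le_compat. unfold l. lra.
  - assert (H := exp_55_8_bound).
    apply Rle_trans with (2 * (10745 / 10000) / l * 1050).
    + apply Rmult_le_compat_l; [|lra]. apply Rle_mult_inv_pos; unfold l; lra.
    + unfold l. nra.
Qed.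

(** * Linear oscillators *)

(** [auto_derive] leaves the derivative of an abstract function eta-expanded; this inserts its known
    value. *)
Ltac rewrite_derive H :=
  match type of H with
  | is_derive ?f ?t ?l =>
      replace (Derive (fun x : R => f x) t) with l
        by (symmetry; exact (is_derive_unique f t l H))
  end.

Lemma is_derive_zero_eq (f : R -> R) (a b x y : R) :
  (forall t, a <= t <= b -> is_derive f t 0) ->
  a <= x <= b -> a <= y <= b -> f x = f y.
Proof.
  intros H Hx Hy. destruct (Rtotal_order x y) as [L|[->|L]]; trivial.
  - apply (eq_is_derive f x y); trivial. intros t Ht. apply H. lra.
  - symmetry. apply (eq_is_derive f y x); trivial. intros t Ht. apply H. lra.
Qed.

(** The expression [v x * cos (w * (t - x)) + v' x / w * sin (w * (t - x))] is constant in [x]: at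
    [x = t] it is [v t], at [x = t0] the claimed formula. *)
Lemma harmonic_oscillator (v v' : R -> R) (w a b t0 t : R) :
  w <> 0 ->
  (forall x, a <= x <= b -> is_derive v x (v' x)) ->
  (forall x, a <= x <= b -> is_derive v' x (- w ^ 2 * v x)) ->
  a <= t0 <= b -> a <= t <= b ->
  v t = v t0 * cos (w * (t - t0)) + v' t0 / w * sin (w * (t - t0)).
Proof.
  intros Hw Hv Hv' Ht0 Ht.
  transitivity (v t * cos (w * (t - t)) + v' t / w * sin (w * (t - t))).
  { replace (w * (t - t)) with 0 by ring. rewrite cos_0, sin_0. ring. }
  apply (is_derive_zero_eq
    (fun x => v x * cos (w * (t - x)) + v' x / w * sin (w * (t - x))) a b); trivial.
  intros x Hx. specialize (Hv x Hx). specialize (Hv' x Hx).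
  auto_derive.
  - repeat split; eexists; eassumption.
  - rewrite_derive Hv. rewrite_derive Hv'.
    field. assumption.
Qed.

(** The factor [exp (m * (x - t0))] turns u'' + 2 m u' + u = 0 into a harmonic oscillation of
    frequency [q]. The sign of [m] is free, so growing oscillations are covered as well. *)
Lemma damped_oscillator (u u' : R -> R) (m q a b t0 t : R) :
  q <> 0 -> m ^ 2 + q ^ 2 = 1 ->
  (forall x, a <= x <= b -> is_derive u x (u' x)) ->
  (forall x, a <= x <= b -> is_derive u' x (- 2 * m * u' x - u x)) ->
  a <= t0 <= b -> a <= t <= b ->
  exp (m * (t - t0)) * u t
  = u t0 * cos (q * (t - t0)) + (u' t0 + m * u t0) / q * sin (q * (t - t0)).
Proof.
  intros Hq Hm Hu Hu' Ht0 Ht.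
  rewrite (harmonic_oscillator (fun x => exp (m * (x - t0)) * u x)
    (fun x => exp (m * (x - t0)) * (u' x + m * u x)) q a b t0 t); trivial.
  - replace (m * (t0 - t0)) with 0 by ring. rewrite exp_0. field. assumption.
  - intros x Hx. specialize (Hu x Hx). auto_derive.
    + eexists; eassumption.
    + rewrite_derive Hu. unfold Rminus. ring.
  - intros x Hx. specialize (Hu x Hx). specialize (Hu' x Hx). auto_derive.
    + repeat split; eexists; eassumption.
    + rewrite_derive Hu. rewrite_derive Hu'.
      replace (q ^ 2) with (1 - m ^ 2) by lra. unfold Rminus. ring.
Qed.

Lemma exp_unbounded (a K C : R) (N : nat) :
  0 < a -> (forall n, (N <= n)%nat -> Rabs K * exp (INR n * a) <= C) -> K = 0.
Proof.
  intros Ha H. destruct (Req_dec K 0) as [|HK]; trivial. exfalso.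
  assert (HK' := Rabs_pos_lt _ HK).
  destruct (nfloor_ex (Rmax 0 (C / (Rabs K * a)))) as [n Hn]; [apply Rmax_l|].
  specialize (H (S n + N)%nat ltac:(lia)).
  assert (He := exp_ineq1_le (INR (S n + N) * a)).
  assert (Hn' : C / (Rabs K * a) < INR (S n + N)).
  { rewrite plus_INR, S_INR. generalize (Rmax_r 0 (C / (Rabs K * a))) (pos_INR N). lra. }
  assert (Hp : 0 < Rabs K * a) by nra.
  apply (Rmult_lt_compat_r (Rabs K * a)) in Hn'; trivial.
  replace (C / (Rabs K * a) * (Rabs K * a)) with C in Hn' by (field; lra).
  nra.
Qed.

(* The unstable factor u = z'' + 2 p z' + z and the stable factor y = z'' - 2 p z' + z
   differ by 4 p z'; boundedness of z' and of y therefore bounds u, which grows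
   exponentially unless it vanishes. *)
Lemma unstable_factor_zero (c p q t0 M : R) (z z1 z2 z3 : R -> R) :
  0 < p -> 0 < q -> p ^ 2 + q ^ 2 = 1 -> 4 * p ^ 2 = 2 - c ^ 2 ->
  (forall t, t0 <= t -> is_derive z t (z1 t)) ->
  (forall t, t0 <= t -> is_derive z1 t (z2 t)) ->
  (forall t, t0 <= t -> is_derive z2 t (z3 t)) ->
  (forall t, t0 <= t -> is_derive z3 t (- c ^ 2 * z2 t - z t)) ->
  (forall t, M <= t -> Rabs (z1 t) <= 1) ->
  forall t, t0 <= t -> z2 t + 2 * p * z1 t + z t = 0 /\ z3 t + 2 * p * z2 t + z1 t = 0.
Proof.
  intros Hp Hq Hpq Hpc D0 D1 D2 D3 HM.
  set (u := fun t => z2 t + 2 * p * z1 t + z t).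
  set (u' := fun t => z3 t + 2 * p * z2 t + z1 t).
  set (y := fun t => z2 t - 2 * p * z1 t + z t).
  set (y' := fun t => z3 t - 2 * p * z2 t + z1 t).
  assert (Du : forall t, t0 <= t -> is_derive u t (u' t)).
  { intros t Ht. specialize (D0 t Ht). specialize (D1 t Ht). specialize (D2 t Ht).
    unfold u, u'. auto_derive.
    - repeat split; eexists; eassumption.
    - rewrite_derive D0. rewrite_derive D1. rewrite_derive D2. ring. }
  assert (Dy : forall t, t0 <= t -> is_derive y t (y' t)).
  { intros t Ht. specialize (D0 t Ht). specialize (D1 t Ht). specialize (D2 t Ht).
    unfold y, y'. auto_derive.
    - repeat split; eexists; eassumption.
    - rewrite_derive D0. rewrite_derive D1. rewrite_derive D2. ring. }
  assert (Du' : forall t, t0 <= t -> is_derive u' t (- 2 * (- p) * u' t - u t)).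
  { intros t Ht. specialize (D3 t Ht). specialize (D1 t Ht). specialize (D2 t Ht).
    unfold u, u'. auto_derive.
    - repeat split; eexists; eassumption.
    - rewrite_derive D3. rewrite_derive D1. rewrite_derive D2. replace (c ^ 2) with (2 - 4 * p ^ 2) by lra. ring. }
  assert (Dy' : forall t, t0 <= t -> is_derive y' t (- 2 * p * y' t - y t)).
  { intros t Ht. specialize (D3 t Ht). specialize (D1 t Ht). specialize (D2 t Ht).
    unfold y, y'. auto_derive.
    - repeat split; eexists; eassumption.
    - rewrite_derive D3. rewrite_derive D1. rewrite_derive D2. replace (c ^ 2) with (2 - 4 * p ^ 2) by lra. ring. }
  assert (HPI := PI_RGT_0).
  assert (Hu0 : forall t, t0 <= t -> u t = 0).
  { intros b Hb.
    destruct (nfloor_ex (Rmax 0 ((M - b) * q / (2 * PI)))) as [N HN]; [apply Rmax_l|].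
    apply (exp_unbounded (2 * PI * p / q) (u b)
      (4 * p + Rabs (y b)) (S N)).
    { apply Rdiv_lt_0_compat; nra. }
    (* After [n] full periods the sine terms vanish: [u] has been multiplied by exp (p (t - b)) and
       [y] by its inverse. The choice of [N] puts [t] beyond [M]. *)
    intros n Hn. set (t := b + INR n * (2 * PI / q)).
    assert (Hdt : 0 <= INR n * (2 * PI / q)).
    { apply Rmult_le_pos; [apply pos_INR|]. apply Rlt_le, Rdiv_lt_0_compat; lra. }
    assert (Hbt : b <= t) by (unfold t; lra).
    assert (HMt : M <= t).
    { apply le_INR in Hn. rewrite S_INR in Hn.
      assert (H : (M - b) * q / (2 * PI) <= INR n)
        by (generalize (Rmax_r 0 ((M - b) * q / (2 * PI))); lra).
      apply (Rmult_le_compat_r (2 * PI / q)) in H; [|apply Rlt_le, Rdiv_lt_0_compat; lra].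
      replace ((M - b) * q / (2 * PI) * (2 * PI / q)) with (M - b) in H by (field; lra).
      unfold t. lra. }
    assert (Eu := damped_oscillator u u' (- p) q b t b t).
    assert (Ey := damped_oscillator y y' p q b t b t).
    specialize (Eu ltac:(lra) ltac:(nra) (fun x Hx => Du x ltac:(lra))
      (fun x Hx => Du' x ltac:(lra)) ltac:(lra) ltac:(lra)).
    specialize (Ey ltac:(lra) ltac:(nra) (fun x Hx => Dy x ltac:(lra))
      (fun x Hx => Dy' x ltac:(lra)) ltac:(lra) ltac:(lra)).
    replace (q * (t - b)) with (0 + 2 * INR n * PI) in Eu, Ey by (unfold t; field; lra).
    rewrite cos_period, sin_period, cos_0, sin_0, Rmult_1_r, Rmult_0_r, Rplus_0_r in Eu, Ey.
    assert (HE : 1 <= exp (p * (t - b))).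
    { generalize (exp_ineq1_le (p * (t - b))). nra. }
    assert (Hee : exp (p * (t - b)) * exp (- p * (t - b)) = 1).
    { rewrite <- exp_plus. replace (_ + _) with 0 by ring. apply exp_0. }
    replace (INR n * (2 * PI * p / q)) with (p * (t - b)) by (unfold t; field; lra).
    rewrite <- Eu, Rabs_mult, (Rabs_pos_eq (exp _)) by apply Rlt_le, exp_pos.
    replace (exp (- p * (t - b)) * Rabs (u t) * exp (p * (t - b))) with (Rabs (u t))
      by (rewrite <- (Rmult_1_l (Rabs (u t))) at 1; rewrite <- Hee; ring).
    replace (u t) with (4 * p * z1 t + y t) by (unfold u, y; ring).
    assert (Hyb : Rabs (y t) <= Rabs (y b)).
    { rewrite <- Ey, Rabs_mult, (Rabs_pos_eq (exp _)) by lra.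
      generalize (Rabs_pos (y t)). nra. }
    apply Rle_trans with (Rabs (4 * p * z1 t) + Rabs (y t)); [apply Rabs_triang|].
    rewrite (Rabs_mult (4 * p)), (Rabs_pos_eq (4 * p)) by lra.
    generalize (HM t HMt). nra. }
  intros t Ht. split; [now apply Hu0|].
  (* A quarter period later only the sine term survives, and its coefficient is [u' t / q] because
     [u] vanishes. *)
  assert (Eu := damped_oscillator u u' (- p) q t (t + PI / 2 / q) t (t + PI / 2 / q)).
  assert (0 < PI / 2 / q) by (apply Rdiv_lt_0_compat; lra).
  specialize (Eu ltac:(lra) ltac:(nra) (fun x Hx => Du x ltac:(lra))
    (fun x Hx => Du' x ltac:(lra)) ltac:(lra) ltac:(lra)).
  replace (q * (t + PI / 2 / q - t)) with (PI / 2) in Eu by (field; lra).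
  rewrite !Hu0, sin_PI2 in Eu by lra.
  fold (u' t). apply (Rmult_eq_reg_r (/ q)); [|apply Rinv_neq_0_compat; lra].
  unfold Rdiv in Eu. lra.
Qed.

(** * Frequencies and phases *)

(** The characteristic roots are ±p ± iq above level -1 (X^4 + c^2 X^2 + 1) and ±i w1, ±i w2 below
    it (X^4 + c^2 X^2 + xi). *)
Record wave_params (c xi p q w1 w2 : R) : Prop := {
  wp_c : 0 < c;
  wp_p : 0 < p;
  wp_q : p < q;
  wp_pq : p ^ 2 + q ^ 2 = 1;
  wp_pc : 4 * p ^ 2 = 2 - c ^ 2;
  wp_w2 : 0 < w2;
  wp_w12 : w2 < w1;
  wp_sum : w1 ^ 2 + w2 ^ 2 = c ^ 2;
  wp_prod : w1 ^ 2 * w2 ^ 2 = xi;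
  wp_xi : xi < 1 }.

(** The bound [xi < c ^ 4 / 4] makes the inner frequencies real and distinct; [c < sqrt 2] makes [p]
    real and positive and gives [xi < 1]. *)
Lemma wave_params_exist (c xi : R) :
  0 < c -> c < sqrt 2 -> 0 < xi -> xi < c ^ 4 / 4 ->
  exists p q w1 w2, wave_params c xi p q w1 w2.
Proof.
  intros Hc Hc2 Hxi Hxi4.
  assert (H2 : c ^ 2 < 2).
  { generalize (sqrt_sqrt 2 ltac:(lra)). nra. }
  set (r := sqrt (c ^ 4 - 4 * xi)).
  assert (Hr : r ^ 2 = c ^ 4 - 4 * xi) by (apply pow2_sqrt; lra).
  assert (Hr0 : 0 < r) by (apply sqrt_lt_R0; lra).
  assert (Hrc : r < c ^ 2) by nra.
  assert (H4 : c ^ 4 < 4) by nra.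
  assert (E1 : sqrt ((c ^ 2 + r) / 2) ^ 2 = (c ^ 2 + r) / 2) by (apply pow2_sqrt; nra).
  assert (E2 : sqrt ((c ^ 2 - r) / 2) ^ 2 = (c ^ 2 - r) / 2) by (apply pow2_sqrt; nra).
  assert (E3 : sqrt (2 - c ^ 2) ^ 2 = 2 - c ^ 2) by (apply pow2_sqrt; nra).
  assert (E4 : sqrt (2 + c ^ 2) ^ 2 = 2 + c ^ 2) by (apply pow2_sqrt; nra).
  exists (sqrt (2 - c ^ 2) / 2), (sqrt (2 + c ^ 2) / 2),
    (sqrt ((c ^ 2 + r) / 2)), (sqrt ((c ^ 2 - r) / 2)).
  split; try nra.
  - generalize (sqrt_lt_R0 (2 - c ^ 2)). nra.
  - generalize (sqrt_lt_1 (2 - c ^ 2) (2 + c ^ 2)). nra.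
  - apply sqrt_lt_R0. lra.
  - apply sqrt_lt_1; nra.
Qed.

(** The brackets are the real and imaginary parts of (x + iy)(1 + i sg), which for positive [r] has
    argument k + atan sg; the equation says that [th] agrees with it modulo pi. *)
Lemma sin_phase_zero (th sg r k x y : R) :
  r <> 0 -> x = r * cos k -> y = r * sin k ->
  sin th * (x - sg * y) = cos th * (y + sg * x) ->
  sin (th - atan sg - k) = 0.
Proof.
  intros Hr -> -> H.
  assert (Hs : 0 < sqrt (1 + sg ^ 2)) by (apply sqrt_lt_R0; nra).
  replace (th - atan sg - k) with (th - (atan sg + k)) by ring.
  rewrite sin_minus, cos_plus, sin_plus, sin_atan, cos_atan.
  rewrite Rsqr_pow2.
  apply (Rmult_eq_reg_l (r * sqrt (1 + sg ^ 2))); [|apply Rmult_integral_contrapositive; lra].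
  rewrite Rmult_0_r.
  transitivity (sin th * (r * cos k - sg * (r * sin k)) - cos th * (r * sin k + sg * (r * cos k))).
  - field. lra.
  - lra.
Qed.

Lemma polar_upper_half_plane (x y : R) :
  0 < y -> exists r k, 0 < r /\ x = r * cos k /\ y = r * sin k.
Proof.
  intros Hy.
  assert (Hs : 0 < sqrt (1 + (x / y) ^ 2)) by (apply sqrt_lt_R0; nra).
  exists (y * sqrt (1 + (x / y) ^ 2)), (PI / 2 - atan (x / y)).
  rewrite cos_shift, sin_shift, sin_atan, cos_atan, Rsqr_pow2.
  repeat split; [nra|field; split; lra|field; lra].
Qed.

Lemma atan_diff_bounds (x y : R) : x < y -> 0 < atan y - atan x <= y - x.
Proof.
  intros H. split; [generalize (atan_increasing x y H); lra|].
  destruct (MVT_gen atan x y (fun t => / (1 + t ^ 2))) as [t [Ht E]].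
  - intros t _. rewrite <- Rsqr_pow2. apply is_derive_atan.
  - intros t _. apply derivable_continuous_pt, derivable_pt_atan.
  - rewrite E. assert (/ (1 + t ^ 2) <= 1).
    { rewrite <- Rinv_1. apply Rinv_le_contravar; nra. }
    nra.
Qed.

(** The derivative is w1 / (1 + (w2 s)^2) - w1 / (1 + (w1 s)^2), positive since w2 < w1. Up to a
    constant this function is w1 T - atan (w1 s) with [T] eliminated through the [w2] phase. *)
Lemma phase_increasing (w1 w2 s s' : R) :
  0 < w2 < w1 -> 0 < s < s' ->
  w1 / w2 * atan (w2 * s) - atan (w1 * s) < w1 / w2 * atan (w2 * s') - atan (w1 * s').
Proof.
  intros Hw Hs.
  destruct (MVT_gen (fun s => w1 / w2 * atan (w2 * s) - atan (w1 * s)) s s'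
    (fun s => w1 * / (1 + (w2 * s) ^ 2) - w1 * / (1 + (w1 * s) ^ 2))) as [t [Ht E]].
  - intros t _. auto_derive; trivial. unfold Rsqr. field. repeat split; nra.
  - intros t _. apply derivable_continuous_pt, ex_derive_Reals_0. auto_derive. trivial.
  - rewrite Rmin_left, Rmax_right in Ht by lra.
    assert (/ (1 + (w1 * t) ^ 2) < / (1 + (w2 * t) ^ 2)).
    { apply Rinv_lt_contravar; [nra|].
      assert (0 < w2 * t < w1 * t) by nra. nra. }
    assert (0 < (w1 * / (1 + (w2 * t) ^ 2) - w1 * / (1 + (w1 * t) ^ 2)) * (s' - s))
      by (apply Rmult_lt_0_compat; nra).
    lra.
Qed.

(** With x = p / q one has c^2 = 2 (1 - x^2) / (1 + x^2), and the squared claim is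
    [exp_growth_bound]. *)
Lemma exit_speed_bound (c xi p q w1 w2 : R) :
  wave_params c xi p q w1 w2 -> c * exp (p / q * (PI + atan (q / p))) <= 6 * PI.
Proof.
  intros [Hc Hp Hq Hpq Hpc _ _ _ _ _].
  assert (HPI := PI_bounds).
  assert (Hx : 0 < p / q < 1).
  { split; [apply Rdiv_lt_0_compat; lra|]. apply Rmult_lt_reg_r with q; [lra|].
    replace (p / q * q) with p by (field; lra). lra. }
  assert (H := exp_growth_bound (p / q) Hx).
  replace (q / p) with (/ (p / q)) by (field; lra).
  rewrite atan_inv by lra.
  replace (PI + (PI / 2 - atan (p / q))) with (3 * PI / 2 - atan (p / q)) by field.
  set (E := p / q * (3 * PI / 2 - atan (p / q))) in *.
  replace (2 * E) with (E + E) in H by ring. rewrite exp_plus in H.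
  replace (2 * ((1 - (p / q) ^ 2) / (1 + (p / q) ^ 2))) with (c ^ 2) in H.
  2: { replace (c ^ 2) with (2 * (q ^ 2 - p ^ 2) / (p ^ 2 + q ^ 2))
         by (rewrite Hpq; field_simplify; nra).
       field. repeat split; nra. }
  assert (0 < c * exp E) by (apply Rmult_lt_0_compat; [lra|apply exp_pos]).
  apply Rsqr_incr_0_var; [|lra]. unfold Rsqr. lra.
Qed.

(* a1 and a2 are the amplitudes of the two modes of the trough, with frequencies w1 and w2. *)
Lemma trough_phases (c xi p q w1 w2 T s a1 a2 : R) :
  wave_params c xi p q w1 w2 -> 0 < T ->
  a1 * cos (w1 * T) = 1 - 2 * p * s - / w1 ^ 2 ->
  - w1 * a1 * sin (w1 * T) = (1 - w1 ^ 2) * s - 2 * p ->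
  a2 * cos (w2 * T) = 1 - 2 * p * s - / w2 ^ 2 ->
  - w2 * a2 * sin (w2 * T) = (1 - w2 ^ 2) * s - 2 * p ->
  (forall t, 0 <= t <= T -> a2 * cos (w2 * t) < a1 * cos (w1 * t)) ->
  2 * p / (1 - w2 ^ 2) < s /\
  w2 * T = atan (w2 * s) - atan (w2 * (2 * p / (1 - w2 ^ 2))) /\
  sin (w1 * T) * ((1 - / w1 ^ 2) - w1 * s * (2 * p / w1))
  = cos (w1 * T) * (2 * p / w1 + w1 * s * (1 - / w1 ^ 2)).
Proof.
  intros [Hc Hp Hq Hpq Hpc Hw2 Hw12 Hsum Hprod Hxi] HT C1 S1 C2 S2 Hneg.
  assert (HPI := PI_RGT_0).
  assert (Hw2' : w2 ^ 2 < 1) by nra.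
  (* Adding the squares of the two matching equations gives an amplitude that decreases in [w], so
     the slower mode dominates. *)
  assert (Hamp : forall w a, 0 < w -> w ^ 4 - c ^ 2 * w ^ 2 + xi = 0 ->
     a * cos (w * T) = 1 - 2 * p * s - / w ^ 2 ->
     - w * a * sin (w * T) = (1 - w ^ 2) * s - 2 * p ->
     a ^ 2 = (1 - xi) * (/ w ^ 4 + s ^ 2 * / w ^ 2)).
  { intros w a Hw Hch C S.
    assert (Hcs := sin2_cos2 (w * T)). unfold Rsqr in Hcs.
    transitivity ((a * cos (w * T)) ^ 2 + (- w * a * sin (w * T)) ^ 2 / w ^ 2).
    - transitivity (a ^ 2 * (sin (w * T) * sin (w * T) + cos (w * T) * cos (w * T)));
        [rewrite Hcs; ring|field; lra].
    - rewrite C, S. replace xi with (c ^ 2 * w ^ 2 - w ^ 4) by lra.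
      replace (c ^ 2) with (2 - 4 * p ^ 2) by lra. field. lra. }
  assert (A1 := Hamp w1 a1 ltac:(lra) ltac:(subst xi; rewrite <- Hsum; ring) C1 S1).
  assert (A2 := Hamp w2 a2 ltac:(lra) ltac:(subst xi; rewrite <- Hsum; ring) C2 S2).
  assert (Hlt : a1 ^ 2 < a2 ^ 2).
  { rewrite A1, A2. apply Rmult_lt_compat_l; [lra|].
    assert (/ w1 ^ 2 < / w2 ^ 2).
    { apply Rinv_lt_contravar; [|nra]. apply Rmult_lt_0_compat; nra. }
    assert (/ w1 ^ 4 < / w2 ^ 4).
    { apply Rinv_lt_contravar; [|].
      - apply Rmult_lt_0_compat; apply pow_lt; lra.
      - assert (w2 ^ 2 < w1 ^ 2) by nra. nra. }
    nra. }
  (* At the centre a2 < a1, and a1^2 < a2^2 then forces a2 < 0. *)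
  assert (H0 := Hneg 0 ltac:(lra)). rewrite !Rmult_0_r, cos_0 in H0.
  assert (Ha2 : a2 < 0) by nra.
  (* Otherwise t = pi / w2 lies in the trough, where the slow mode equals -a2 > |a1| and [Hneg]
     fails. *)
  assert (Hpi : w2 * T < PI).
  { destruct (Rlt_le_dec (w2 * T) PI) as [|Hge]; trivial. exfalso.
    assert (Hle : PI / w2 <= T).
    { apply Rmult_le_reg_l with w2; [lra|]. replace (w2 * (PI / w2)) with PI by (field; lra). lra. }
    assert (0 < PI / w2) by (apply Rdiv_lt_0_compat; lra).
    assert (Hm := Hneg (PI / w2) ltac:(lra)).
    replace (w2 * (PI / w2)) with PI in Hm by (field; lra). rewrite cos_PI in Hm.
    generalize (COS_bound (w1 * (PI / w2))).
    assert (- (- a2) < a1 < - a2) by nra. nra. }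
  assert (HwT : 0 < w2 * T) by nra.
  assert (HsinT : 0 < sin (w2 * T)) by (apply sin_gt_0; lra).
  assert (Hs : 0 < (1 - w2 ^ 2) * s - 2 * p).
  { rewrite <- S2. assert (0 < w2 * sin (w2 * T)) by nra. nra. }
  assert (Hs0 : 0 < 2 * p / (1 - w2 ^ 2)) by (apply Rdiv_lt_0_compat; lra).
  assert (Hss : 2 * p / (1 - w2 ^ 2) < s).
  { apply Rmult_lt_reg_l with (1 - w2 ^ 2); [lra|].
    replace ((1 - w2 ^ 2) * (2 * p / (1 - w2 ^ 2))) with (2 * p) by (field; lra). lra. }
  set (s0 := 2 * p / (1 - w2 ^ 2)) in *.
  (* Since w2 < 1 and s > 0, the right-hand side of [C2] is negative, as is [a2]. *)
  assert (HcosT : 0 < cos (w2 * T)).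
  { assert (1 < / w2 ^ 2). { rewrite <- Rinv_1. apply Rinv_lt_contravar; nra. }
    assert (0 < p * s) by nra. nra. }
  assert (HpiT : w2 * T < PI / 2).
  { destruct (Rlt_le_dec (w2 * T) (PI / 2)) as [|Hge]; trivial.
    generalize (cos_le_0 (w2 * T)). lra. }
  assert (Hphase : forall w a, 0 < w ->
     a * cos (w * T) = 1 - 2 * p * s - / w ^ 2 ->
     - w * a * sin (w * T) = (1 - w ^ 2) * s - 2 * p ->
     sin (w * T) * ((1 - / w ^ 2) - w * s * (2 * p / w))
     = cos (w * T) * (2 * p / w + w * s * (1 - / w ^ 2))).
  { intros w a Hw C S.
    replace ((1 - / w ^ 2) - w * s * (2 * p / w)) with (a * cos (w * T)) by (rewrite C; field; lra).
    replace (2 * p / w + w * s * (1 - / w ^ 2)) with (- (- w * a * sin (w * T)) / w)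
      by (rewrite S; field; lra).
    field. lra. }
  split; [assumption|split; [|apply Hphase with a1; trivial; lra]].
  assert (P2 := Hphase w2 a2 ltac:(lra) C2 S2).
  assert (Hsq : 0 < sqrt (1 + (w2 * s0) ^ 2)) by (apply sqrt_lt_R0; nra).
  (* For [w2] the polar form is explicit, with a negative radius: (2 p / w2) / (1 - 1 / w2^2) = - w2
     s0. *)
  apply (sin_phase_zero _ _ ((1 - / w2 ^ 2) * sqrt (1 + (w2 * s0) ^ 2)) (- atan (w2 * s0))) in P2.
  - assert (B1 := atan_bound (w2 * s)). assert (B0 := atan_bound (w2 * s0)).
    assert (0 < atan (w2 * s)) by (rewrite <- atan_0; apply atan_increasing; nra).
    assert (0 < atan (w2 * s0)) by (rewrite <- atan_0; apply atan_increasing; nra).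
    (* [w2 * T] and both arctangents lie in (0, pi/2), so this phase lies in (-pi, pi), where sine
       vanishes only at 0. *)
    assert (w2 * T - atan (w2 * s) - - atan (w2 * s0) = 0); [|lra].
    destruct (Rtotal_order (w2 * T - atan (w2 * s) - - atan (w2 * s0)) 0) as [L|[L|L]]; trivial.
    + generalize (sin_lt_0_var (w2 * T - atan (w2 * s) - - atan (w2 * s0))). lra.
    + generalize (sin_gt_0 (w2 * T - atan (w2 * s) - - atan (w2 * s0))). lra.
  - assert (1 < / w2 ^ 2). { rewrite <- Rinv_1. apply Rinv_lt_contravar; nra. }
    apply Rmult_integral_contrapositive. lra.
  - rewrite cos_neg, cos_atan, Rsqr_pow2. field. lra.
  - rewrite sin_neg, sin_atan, Rsqr_pow2. unfold s0 at 2. field.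
    repeat split; lra.
Qed.

(** * Troughs *)

Lemma solution_is_derive (c xi : R) (z : R -> R) (k : nat) (t : R) :
  is_solution c xi z -> (k < 4)%nat ->
  is_derive (Derive_n z k) t (Derive_n z (S k) t).
Proof.
  intros [[H _] _] Hk. apply Derive_correct. apply (H (S k) t). lia.
Qed.

Lemma solution_ode_above (c xi : R) (z : R -> R) (t : R) :
  is_solution c xi z -> -1 <= z t ->
  Derive_n z 4 t = - c ^ 2 * Derive_n z 2 t - z t.
Proof.
  intros (_ & H & _) Ht. specialize (H t). unfold pos_part, neg_part in H.
  rewrite Rmax_left, Rmax_right in H by lra. lra.
Qed.

Lemma solution_ode_below (c xi : R) (z : R -> R) (t : R) :
  is_solution c xi z -> z t <= -1 ->
  Derive_n z 4 t = - c ^ 2 * Derive_n z 2 t + 1 - xi * (z t + 1).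
Proof.
  intros (_ & H & _) Ht. specialize (H t). unfold pos_part, neg_part in H.
  rewrite Rmax_right, Rmax_left in H by lra. lra.
Qed.

Lemma even_Derive_n (c xi : R) (z : R -> R) (k : nat) (t : R) :
  is_solution c xi z -> is_even z -> (k <= 4)%nat ->
  Derive_n z k (- t) = (-1) ^ k * Derive_n z k t.
Proof.
  intros [[H _] _] He Hk.
  rewrite (Derive_n_ext z (fun x => z (- x)) k (- t)) by (intros x; now rewrite He).
  rewrite Derive_n_comp_opp, Ropp_involutive; trivial.
  apply filter_forall. intros y j Hj. apply H. lia.
Qed.

Lemma solution_continuity (c xi : R) (z : R -> R) : is_solution c xi z -> continuity z.
Proof.
  intros Hz t. apply derivable_continuous_pt, ex_derive_Reals_0.
  eexists. apply (solution_is_derive c xi z 0 t Hz). lia.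
Qed.

Lemma solution_above_stable (c xi p q w1 w2 t0 : R) (z : R -> R) :
  wave_params c xi p q w1 w2 -> is_solution c xi z ->
  (forall t, t0 <= t -> -1 <= z t) ->
  forall t, t0 <= t ->
    Derive_n z 2 t + 2 * p * Derive_n z 1 t + z t = 0 /\
    Derive_n z 3 t + 2 * p * Derive_n z 2 t + Derive_n z 1 t = 0.
Proof.
  intros W Hz Hab.
  assert (HM : exists M, forall t, M < t -> Rabs (Derive_n z 1 t) < 1).
  { destruct Hz as (_ & _ & _ & _ & L & _). apply is_lim_spec in L.
    destruct (L (mkposreal 1 Rlt_0_1)) as [M HM]. exists M. intros t Ht.
    specialize (HM t Ht). simpl in HM. now rewrite Rminus_0_r in HM. }
  destruct HM as [M HM].
  apply (unstable_factor_zero c p q t0 (M + 1) z (Derive_n z 1) (Derive_n z 2) (Derive_n z 3)).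
  - apply W.
  - generalize (wp_p _ _ _ _ _ _ W) (wp_q _ _ _ _ _ _ W). lra.
  - apply W.
  - apply W.
  - intros t _. apply (solution_is_derive c xi z 0 t Hz). lia.
  - intros t _. apply (solution_is_derive c xi z 1 t Hz). lia.
  - intros t _. apply (solution_is_derive c xi z 2 t Hz). lia.
  - intros t Ht. rewrite <- (solution_ode_above c xi z t Hz) by auto.
    apply (solution_is_derive c xi z 3 t Hz). lia.
  - intros t Ht. apply Rlt_le, HM. lra.
Qed.

Record trough (c xi : R) (z : R -> R) (T s : R) : Prop := {
  tr_sol : is_solution c xi z;
  tr_even : is_even z;
  tr_pos : 0 < T;
  tr_level : z T = -1;
  tr_slope : Derive_n z 1 T = s;
  tr_inside : forall t, - T <= t <= T -> z t <= -1;
  tr_outside : forall t, T < t -> -1 < z t }.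

(** Evenness makes the two points opposite, and decay with the intermediate value theorem fixes the
    sign outside. What must be excluded is a solution touching -1 from above. *)
Lemma one_troughed_trough (c xi p q w1 w2 : R) (z : R -> R) :
  wave_params c xi p q w1 w2 ->
  is_solution c xi z -> is_even z -> one_troughed z -> exists T s, trough c xi z T s.
Proof.
  intros W Hz He Ho.
  assert (HT : exists T, 0 < T /\ forall t, z t = -1 <-> (t = T \/ t = - T)).
  { destruct Ho as (t1 & t2 & Hne & H).
    assert (E : t2 = - t1).
    { assert (H1 : - t1 = t1 \/ - t1 = t2).
      { apply H. rewrite He. apply H. now left. }
      assert (H2 : - t2 = t1 \/ - t2 = t2).
      { apply H. rewrite He. apply H. now right. }
      lra. }
    subst t2. destruct (Rlt_le_dec 0 t1) as [L|L].
    - now exists t1.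
    - exists (- t1). split; [lra|]. intros t. rewrite H, Ropp_involutive. tauto. }
  destruct HT as (T & HT & Hroot).
  assert (Hcont := solution_continuity c xi z Hz).
  assert (Hlevel : z T = -1) by (apply Hroot; now left).
  assert (Hivt : forall a b, z a < -1 -> -1 < z b ->
    exists x, Rmin a b <= x <= Rmax a b /\ z x = -1).
  { intros a b Ha Hb.
    destruct (IVT_gen z a b (-1) Hcont) as [x Hx]; [|now exists x].
    rewrite Rmin_left, Rmax_right; lra. }
  assert (Hout : forall t, T < t -> -1 < z t).
  { intros t Ht. destruct (Rlt_le_dec (-1) (z t)) as [|Hle]; trivial. exfalso.
    destruct Hle as [Hlt|Heq]; [|apply Hroot in Heq; lra].
    assert (L : is_lim z p_infty 0) by apply Hz. apply is_lim_spec in L.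
    destruct (L (mkposreal 1 Rlt_0_1)) as [M HM]. simpl in HM.
    set (t' := Rmax t M + 1).
    assert (t <= Rmax t M) by apply Rmax_l. assert (M <= Rmax t M) by apply Rmax_r.
    assert (Ht' := HM t' ltac:(unfold t'; lra)).
    rewrite Rminus_0_r in Ht'. apply Rabs_def2 in Ht'.
    destruct (Hivt t t') as (x & Hx & Ex); [lra|lra|].
    rewrite Rmin_left, Rmax_right in Hx by (unfold t'; lra).
    apply Hroot in Ex. lra. }
  exists T, (Derive_n z 1 T). split; trivial.
  assert (Hno : forall t, - T < t < T -> z t <> -1).
  { intros t Ht E. apply Hroot in E. lra. }
  assert (H0 : z 0 < -1).
  { destruct (Rlt_le_dec (z 0) (-1)) as [|Hge]; trivial. exfalso.
    assert (Hall : forall t, -1 <= z t).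
    { assert (Hpos : forall t, 0 <= t -> -1 <= z t).
      { intros t Ht. destruct (Rlt_le_dec (z t) (-1)) as [Hlt|]; trivial. exfalso.
        assert (Ht' : t < T).
        { destruct (Rlt_le_dec t T) as [|[Hgt|<-]]; trivial; [|lra].
          generalize (Hout t Hgt). lra. }
        assert (z 0 <> -1) by (apply Hno; lra).
        destruct (Hivt t 0) as (x & Hx & Ex); [lra|lra|].
        rewrite Rmin_right, Rmax_left in Hx by lra.
        apply Hno in Ex; lra. }
      intros t. destruct (Rle_lt_dec 0 t) as [|Hlt]; [now apply Hpos|].
      rewrite <- He. apply Hpos. lra. }
    assert (HW := wp_p _ _ _ _ _ _ W).
    assert (Hst : forall t, Derive_n z 2 t + 2 * p * Derive_n z 1 t + z t = 0).
    { intros t.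
      exact (proj1 (solution_above_stable c xi p q w1 w2 t z W Hz (fun x _ => Hall x)
        t (Rle_refl t))). }
    assert (Hd1 : forall t, Derive_n z 1 t = 0).
    { intros t. assert (H1 := Hst t). assert (H2 := Hst (- t)).
      rewrite (even_Derive_n c xi z 2), (even_Derive_n c xi z 1), He in H2 by (trivial; lia).
      simpl pow in H2. nra. }
    assert (Hd2 : Derive_n z 2 T = 0).
    { change (Derive (Derive_n z 1) T = 0).
      rewrite (Derive_ext _ (fun _ => 0)) by exact Hd1. apply Derive_const. }
    generalize (Hst T). rewrite Hd1, Hd2, Hlevel. lra. }
  intros t Ht. destruct (Rle_lt_dec (z t) (-1)) as [|Hgt]; trivial. exfalso.
  assert (Htt : - T < t < T).
  { split.
    - destruct (Req_dec t (- T)) as [->|]; [rewrite He in Hgt|]; lra.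
    - destruct (Req_dec t T) as [->|]; lra. }
  destruct (Hivt 0 t) as (x & Hx & Ex); trivial.
  apply Hno in Ex; trivial.
  assert (Rmin 0 t > - T) by (apply Rmin_glb_lt; lra).
  assert (Rmax 0 t < T) by (apply Rmax_lub_lt; lra). lra.
Qed.

(** From [T] on the stable second-order equation holds, so z = -1 and z' = s at [T] determine the
    other derivatives there and the whole outer branch. *)
Lemma trough_exit_data (c xi p q w1 w2 T s : R) (z : R -> R) :
  wave_params c xi p q w1 w2 -> trough c xi z T s ->
  Derive_n z 2 T = 1 - 2 * p * s /\ Derive_n z 3 T = (1 - c ^ 2) * s - 2 * p /\
  forall t, T <= t ->
    exp (p * (t - T)) * z t = - cos (q * (t - T)) + (s - p) / q * sin (q * (t - T)).
Proof.
  intros W [Hz He HT Hl Hs Hin Hout].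
  assert (Hst : forall t, T <= t ->
    Derive_n z 2 t + 2 * p * Derive_n z 1 t + z t = 0 /\
    Derive_n z 3 t + 2 * p * Derive_n z 2 t + Derive_n z 1 t = 0).
  { apply (solution_above_stable c xi p q w1 w2); trivial.
    intros t [Ht|<-]; [apply Rlt_le; auto|lra]. }
  assert (Hpc := wp_pc _ _ _ _ _ _ W). assert (Hpp := wp_p _ _ _ _ _ _ W).
  assert (Hq := wp_q _ _ _ _ _ _ W).
  destruct (Hst T (Rle_refl T)) as [E2 E3]. rewrite Hl, Hs in *.
  assert (F2 : Derive_n z 2 T = 1 - 2 * p * s) by lra.
  repeat split; [lra| |].
  { rewrite F2 in E3. replace (c ^ 2) with (2 - 4 * p ^ 2) by lra. lra. }
  intros t Ht.
  rewrite (damped_oscillator z (Derive_n z 1) p q T t T t); try lra.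
  - rewrite Hl, Hs. field. lra.
  - apply W.
  - intros x _. apply (solution_is_derive c xi z 0 x Hz). lia.
  - intros x Hx. replace (- 2 * p * Derive_n z 1 x - z x) with (Derive_n z 2 x)
      by (generalize (proj1 (Hst x ltac:(lra))); lra).
    apply (solution_is_derive c xi z 1 x Hz). lia.
Qed.

(** The outer branch is affine in [s] with coefficient exp (-p tau) sin (q tau) / q. At the first
    minimum of that coefficient the cosine and sine are -p and -q, so exp (p tau) z = 2 p - s, and z
    > -1 bounds [s]. *)
Lemma trough_exit_speed (c xi p q w1 w2 T s : R) (z : R -> R) :
  wave_params c xi p q w1 w2 -> trough c xi z T s ->
  s - 2 * p < exp (p / q * (PI + atan (q / p))).
Proof.
  intros W Htr. destruct (trough_exit_data c xi p q w1 w2 T s z W Htr) as (_ & _ & H).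
  assert (Hp := wp_p _ _ _ _ _ _ W). assert (Hq := wp_q _ _ _ _ _ _ W).
  assert (Hpq := wp_pq _ _ _ _ _ _ W).
  (* q (t - T) = f is the first minimum of the damped oscillation. *)
  set (f := PI + atan (q / p)).
  assert (Hf : 0 < f).
  { unfold f. generalize PI_RGT_0 (atan_bound (q / p)). lra. }
  assert (Htau : 0 < f / q) by (apply Rdiv_lt_0_compat; lra).
  specialize (H (T + f / q) ltac:(lra)).
  assert (Hz := tr_outside _ _ _ _ _ Htr (T + f / q) ltac:(lra)).
  replace (p * (T + f / q - T)) with (p / q * f) in H by (field; lra).
  replace (q * (T + f / q - T)) with (atan (q / p) + PI) in H by (unfold f; field; lra).
  rewrite neg_cos, neg_sin, sin_atan, cos_atan, Rsqr_pow2 in H.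
  replace (1 + (q / p) ^ 2) with ((/ p) ^ 2) in H
    by (transitivity ((p ^ 2 + q ^ 2) / p ^ 2); [rewrite Hpq|]; field; lra).
  rewrite sqrt_pow2 in H by (apply Rlt_le, Rinv_0_lt_compat; lra).
  replace (- - (1 / / p) + (s - p) / q * - (q / p / / p)) with (2 * p - s) in H
    by (field; lra).
  generalize (exp_pos (p / q * f)). nra.
Qed.

(** In the trough (D^2 + wa^2)(D^2 + wb^2)(z + 1 - 1/xi) = 0, so applying D^2 + wb^2 isolates the
    mode of frequency [wa]. *)
Lemma trough_mode (c xi wa wb T s : R) (z : R -> R) :
  trough c xi z T s -> 0 < wa -> 0 < wb ->
  wa ^ 2 + wb ^ 2 = c ^ 2 -> wa ^ 2 * wb ^ 2 = xi ->
  let d t := Derive_n z 2 t + wb ^ 2 * (z t + 1 - / xi) in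
  let d' t := Derive_n z 3 t + wb ^ 2 * Derive_n z 1 t in
  forall t0 t, - T <= t0 <= T -> - T <= t <= T ->
    d t = d t0 * cos (wa * (t - t0)) + d' t0 / wa * sin (wa * (t - t0)) /\
    d' t = - wa * d t0 * sin (wa * (t - t0)) + d' t0 * cos (wa * (t - t0)).
Proof.
  intros [Hz He HT Hl Hs Hin Hout] Ha Hb Hsum Hprod d d' t0 t Ht0 Ht.
  assert (Dd : forall x, - T <= x <= T -> is_derive d x (d' x)).
  { intros x Hx. unfold d, d'.
    assert (D0 := solution_is_derive c xi z 0 x Hz ltac:(lia)).
    assert (D2 := solution_is_derive c xi z 2 x Hz ltac:(lia)).
    change (Derive_n z 0) with z in D0.
    set (z1 := Derive_n z 1) in *. set (z2 := Derive_n z 2) in *. set (z3 := Derive_n z 3) in *.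
    auto_derive.
    - repeat split; eexists; eassumption.
    - rewrite_derive D0. rewrite_derive D2. ring. }
  assert (Dd' : forall x, - T <= x <= T -> is_derive d' x (- wa ^ 2 * d x)).
  { intros x Hx. unfold d, d'.
    assert (D3 := solution_is_derive c xi z 3 x Hz ltac:(lia)).
    assert (D1 := solution_is_derive c xi z 1 x Hz ltac:(lia)).
    rewrite (solution_ode_below c xi z x Hz (Hin x Hx)) in D3.
    set (z1 := Derive_n z 1) in *. set (z2 := Derive_n z 2) in *. set (z3 := Derive_n z 3) in *.
    auto_derive.
    - repeat split; eexists; eassumption.
    - rewrite_derive D1. rewrite_derive D3. rewrite <- Hsum, <- Hprod. field. lra. }
  split.
  - apply (harmonic_oscillator d d' wa (- T) T); trivial. lra.
  - rewrite (harmonic_oscillator d' (fun x => - wa ^ 2 * d x) wa (- T) T t0 t); trivial.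
    + field. lra.
    + lra.
    + intros x Hx. specialize (Dd x Hx). auto_derive.
      * eexists; eassumption.
      * rewrite_derive Dd. ring.
Qed.

(** Evenness kills the odd derivatives at 0, so both modes are pure cosines; the exit data at [T]
    then supply the equations of [trough_phases]. *)
Lemma trough_phase_conditions (c xi p q w1 w2 T s : R) (z : R -> R) :
  wave_params c xi p q w1 w2 -> trough c xi z T s ->
  2 * p / (1 - w2 ^ 2) < s /\
  w2 * T = atan (w2 * s) - atan (w2 * (2 * p / (1 - w2 ^ 2))) /\
  sin (w1 * T) * ((1 - / w1 ^ 2) - w1 * s * (2 * p / w1))
  = cos (w1 * T) * (2 * p / w1 + w1 * s * (1 - / w1 ^ 2)).
Proof.
  intros W Htr.
  destruct (trough_exit_data c xi p q w1 w2 T s z W Htr) as (E2 & E3 & _).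
  assert (W' := W). destruct W' as [Hc Hp Hq Hpq Hpc Hw2 Hw12 Hsum Hprod Hxi].
  destruct (Htr) as [Hz He HT Hl Hs Hin _].
  assert (O1 : Derive_n z 1 0 = 0).
  { generalize (even_Derive_n c xi z 1 0 Hz He ltac:(lia)). rewrite Ropp_0. simpl pow. lra. }
  assert (O3 : Derive_n z 3 0 = 0).
  { generalize (even_Derive_n c xi z 3 0 Hz He ltac:(lia)). rewrite Ropp_0. simpl pow. lra. }
  assert (M1 := trough_mode c xi w1 w2 T s z Htr ltac:(lra) Hw2 Hsum Hprod).
  assert (M2 := trough_mode c xi w2 w1 T s z Htr Hw2 ltac:(lra) ltac:(lra) ltac:(lra)).
  cbv zeta in M1, M2.
  assert (Hxi0 : 0 < xi).
  { rewrite <- Hprod. apply Rmult_lt_0_compat; apply pow_lt; lra. }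
  assert (Hinv : 0 < / xi) by now apply Rinv_0_lt_compat.
  assert (I1 : w2 ^ 2 * / xi = / w1 ^ 2) by (rewrite <- Hprod; field; lra).
  assert (I2 : w1 ^ 2 * / xi = / w2 ^ 2) by (rewrite <- Hprod; field; lra).
  set (a1 := Derive_n z 2 0 + w2 ^ 2 * (z 0 + 1 - / xi)).
  set (a2 := Derive_n z 2 0 + w1 ^ 2 * (z 0 + 1 - / xi)).
  apply (trough_phases c xi p q w1 w2 T s a1 a2); trivial.
  - destruct (M1 0 T ltac:(lra) ltac:(lra)) as [M _].
    rewrite O1, O3, E2, Hl, Rminus_0_r in M. fold a1 in M. lra.
  - destruct (M1 0 T ltac:(lra) ltac:(lra)) as [_ M].
    rewrite O1, O3, E3, Hs, Rminus_0_r, <- Hsum in M. fold a1 in M. lra.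
  - destruct (M2 0 T ltac:(lra) ltac:(lra)) as [M _].
    rewrite O1, O3, E2, Hl, Rminus_0_r in M. fold a2 in M. lra.
  - destruct (M2 0 T ltac:(lra) ltac:(lra)) as [_ M].
    rewrite O1, O3, E3, Hs, Rminus_0_r, <- Hsum in M. fold a2 in M. lra.
  (* The slow mode minus the fast one is (w1^2 - w2^2)(z + 1 - 1/xi), negative because z <= -1. *)
  - intros t Ht.
    destruct (M1 0 t ltac:(lra) ltac:(lra)) as [N1 _].
    destruct (M2 0 t ltac:(lra) ltac:(lra)) as [N2 _].
    rewrite O1, O3, Rminus_0_r in N1, N2. fold a1 in N1. fold a2 in N2.
    assert (Hzt := Hin t ltac:(lra)).
    assert (w2 ^ 2 < w1 ^ 2) by nra.
    nra.
Qed.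

(** Outside the trough the formula depends on [T] and [s] only. Inside, both modes are fixed by
    their data at [T], and their difference recovers z; evenness covers negative [t]. *)
Lemma trough_unique (c xi p q w1 w2 T s : R) (z y : R -> R) :
  wave_params c xi p q w1 w2 -> trough c xi z T s -> trough c xi y T s -> z = y.
Proof.
  intros W Hz Hy.
  destruct (trough_exit_data c xi p q w1 w2 T s z W Hz) as (Z2 & Z3 & Zout).
  destruct (trough_exit_data c xi p q w1 w2 T s y W Hy) as (Y2 & Y3 & Yout).
  destruct W as [Hc Hp Hq Hpq Hpc Hw2 Hw12 Hsum Hprod Hxi].
  assert (HT := tr_pos _ _ _ _ _ Hz).
  assert (Hnn : forall t, 0 <= t -> z t = y t).
  { intros t Ht. destruct (Rle_lt_dec T t) as [HTt|HTt].
    - apply (Rmult_eq_reg_l (exp (p * (t - T)))); [|generalize (exp_pos (p * (t - T))); lra].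
      rewrite Zout, Yout; trivial.
    - assert (Mz1 := trough_mode c xi w1 w2 T s z Hz ltac:(lra) Hw2 Hsum Hprod T t ltac:(lra) ltac:(lra)).
      assert (Mz2 := trough_mode c xi w2 w1 T s z Hz Hw2 ltac:(lra) ltac:(lra) ltac:(lra) T t ltac:(lra) ltac:(lra)).
      assert (My1 := trough_mode c xi w1 w2 T s y Hy ltac:(lra) Hw2 Hsum Hprod T t ltac:(lra) ltac:(lra)).
      assert (My2 := trough_mode c xi w2 w1 T s y Hy Hw2 ltac:(lra) ltac:(lra) ltac:(lra) T t ltac:(lra) ltac:(lra)).
      destruct Mz1 as [Mz1 _], Mz2 as [Mz2 _], My1 as [My1 _], My2 as [My2 _].
      rewrite Z2, Z3, (tr_slope _ _ _ _ _ Hz), (tr_level _ _ _ _ _ Hz) in Mz1, Mz2.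
      rewrite Y2, Y3, (tr_slope _ _ _ _ _ Hy), (tr_level _ _ _ _ _ Hy) in My1, My2.
      rewrite <- My1 in Mz1. rewrite <- My2 in Mz2.
      assert (w2 ^ 2 < w1 ^ 2) by nra.
      apply (Rmult_eq_reg_l (w1 ^ 2 - w2 ^ 2)); lra. }
  apply functional_extensionality. intros t.
  destruct (Rle_lt_dec 0 t) as [Ht|Ht]; [auto|].
  rewrite <- (tr_even _ _ _ _ _ Hz t), <- (tr_even _ _ _ _ _ Hy t). apply Hnn. lra.
Qed.

(** * Counting solutions by an integer phase *)

(** Each label in the window contributes its only element, or an arbitrary filler if nothing carries
    it. *)
Lemma list_of_integer_labels {A : Type} (P : A -> Z -> Prop) (k0 : Z) (n : nat) :
  (forall k x y, P x k -> P y k -> x = y) -> inhabited A ->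
  exists l : list A, length l = n /\
    forall x k, (k0 <= k < k0 + Z.of_nat n)%Z -> P x k -> In x l.
Proof.
  intros Hinj [a]. induction n as [|n (l & Hl & H)].
  { exists nil. split; trivial. intros x k Hk. lia. }
  destruct (classic (exists x, P x (k0 + Z.of_nat n)%Z)) as [[x Hx]|Hno].
  - exists (x :: l). split; [simpl; lia|]. intros y k Hk Hy.
    destruct (Z.eq_dec k (k0 + Z.of_nat n)) as [->|Hne].
    + left. exact (Hinj _ _ _ Hx Hy).
    + right. apply (H y k); trivial. lia.
  - exists (a :: l). split; [simpl; lia|]. intros y k Hk Hy.
    destruct (Z.eq_dec k (k0 + Z.of_nat n)) as [->|Hne].
    + destruct Hno. now exists y.
    + right. apply (H y k); trivial. lia.
Qed.

Theorem theorem4 (c xi : R) :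
  0 < c -> c < sqrt 2 -> 0 < xi -> xi < c ^ 4 / 4 ->
  exists l : list (R -> R), (length l <= 6)%nat /\
    forall z : R -> R,
      is_solution c xi z -> is_even z -> one_troughed z -> In z l.
Proof.
  intros Hc Hc2 Hxi Hxi4.
  destruct (wave_params_exist c xi Hc Hc2 Hxi Hxi4) as (p & q & w1 & w2 & W).
  assert (W' := W). destruct W' as [_ Hp Hq Hpq Hpc Hw2 Hw12 Hsum Hprod Hxi1].
  destruct (polar_upper_half_plane (1 - / w1 ^ 2) (2 * p / w1)) as (r & kappa & Hr & Ex & Ey).
  { apply Rdiv_lt_0_compat; lra. }
  set (s0 := 2 * p / (1 - w2 ^ 2)).
  assert (Hw2' : w2 ^ 2 < 1) by nra.
  assert (Hs0 : 2 * p <= s0).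
  { unfold s0. apply Rmult_le_reg_r with (1 - w2 ^ 2); [lra|].
    replace (2 * p / (1 - w2 ^ 2) * (1 - w2 ^ 2)) with (2 * p) by (field; lra). nra. }
  (* The label of a solution is the branch [k] of its [w1] phase condition. Equal labels force equal
     [s] by monotonicity, then equal [T], then equal solutions. *)
  set (P := fun z k => exists T s, trough c xi z T s /\ w1 * T - atan (w1 * s) - kappa = IZR k * PI).
  assert (HPI := PI_RGT_0).
  assert (HwT : forall T s, w2 * T = atan (w2 * s) - atan (w2 * s0) ->
     w1 * T = w1 / w2 * atan (w2 * s) - w1 / w2 * atan (w2 * s0)).
  { intros T s H. rewrite <- Rmult_minus_distr_l, <- H. field. lra. }
  assert (Pinj : forall k z y, P z k -> P y k -> z = y).
  { intros k z y (T & s & Tz & Kz) (T' & s' & Ty & Ky).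
    destruct (trough_phase_conditions c xi p q w1 w2 T s z W Tz) as (Bz & Cz & _).
    destruct (trough_phase_conditions c xi p q w1 w2 T' s' y W Ty) as (By & Cy & _).
    fold s0 in Bz, By, Cz, Cy.
    assert (Dz := HwT _ _ Cz). assert (Dy := HwT _ _ Cy).
    assert (E : s = s').
    { destruct (Rtotal_order s s') as [L|[L|L]]; trivial; exfalso.
      - generalize (phase_increasing w1 w2 s s'). lra.
      - generalize (phase_increasing w1 w2 s' s). lra. }
    subst s'. assert (T = T') by (apply (Rmult_eq_reg_l w2); lra). subst T'.
    exact (trough_unique c xi p q w1 w2 T s z y W Tz Ty). }
  (* [a] is the phase at the limit s = s0, T = 0, in units of pi. Labels lie strictly between [a]
     and [a + 6], hence among the six integers starting at [up a]. *)
  set (a := (- atan (w1 * s0) - kappa) / PI).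
  destruct (list_of_integer_labels P (up a) 6 Pinj (inhabits (fun _ => 0))) as (l & Hl & Hin).
  exists l. split; [lia|]. intros z Hz He Ho.
  destruct (one_troughed_trough c xi p q w1 w2 z W Hz He Ho) as (T & s & Tz).
  destruct (trough_phase_conditions c xi p q w1 w2 T s z W Tz) as (Bz & Cz & Sz).
  fold s0 in Bz, Cz.
  apply (sin_phase_zero _ _ r kappa) in Sz; trivial; [|lra].
  apply sin_eq_0_0 in Sz. destruct Sz as [k Hk].
  apply (Hin z k); [|now exists T, s].
  assert (Dz := HwT _ _ Cz).
  assert (Hinc := phase_increasing w1 w2 s0 s ltac:(lra) ltac:(lra)).
  assert (Hlow : a * PI < IZR k * PI).
  { unfold a. replace ((- atan (w1 * s0) - kappa) / PI * PI) with (- atan (w1 * s0) - kappa)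
      by (field; lra). lra. }
  assert (Hup : IZR k * PI < (a + 6) * PI).
  { unfold a. replace (((- atan (w1 * s0) - kappa) / PI + 6) * PI)
      with (- atan (w1 * s0) - kappa + 6 * PI) by (field; lra).
    (* [A1] lets the growing arctangent be dropped, and [A2] gives T <= s - s0 <= s - 2 p, so the
       phase exceeds its limit by less than w1 T < 6 pi. *)
    assert (A1 := atan_diff_bounds (w1 * s0) (w1 * s) ltac:(nra)).
    assert (A2 := atan_diff_bounds (w2 * s0) (w2 * s) ltac:(nra)).
    assert (HTs : T <= s - s0) by (apply Rmult_le_reg_l with w2; lra).
    assert (Hsp := trough_exit_speed c xi p q w1 w2 T s z W Tz).
    assert (Hb := exit_speed_bound c xi p q w1 w2 W).
    assert (w1 < c) by nra.
    assert (w1 * T <= c * exp (p / q * (PI + atan (q / p)))) by nra.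
    lra. }
  apply Rmult_lt_reg_r in Hlow, Hup; trivial.
  destruct (archimed a) as [U1 U2].
  split.
  - apply Z.lt_pred_le, lt_IZR. unfold Z.pred. rewrite plus_IZR. lra.
  - apply lt_IZR. rewrite plus_IZR. simpl. lra.
Qed.
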